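(* If a topological group $(G,\tau)$ is $\tau_g$-representable in $X$ and $Y$ is a $G$-extension of $X$, then $(G,\tau)$ is $\tau_g$-representable in $Y$.
   Context: All spaces are Tychonoff; actions are effective. An equiuniformity on a $G$-space $X$ is a uniformity $\mathcal U$ inducing the topology of $X$ such that every $g\in G$ is uniformly continuous and for every uniform cover $u\in\mathcal U$ there are a neighbourhood $O$ of $e\in G$ and $v\in\mathcal U$ such that $\{OV\mid V\in v\}$ refines $u$. $X$ is $G$-Tychonoff if it has an equiuniformity. If $\mathcal U$ is an equiuniformity on $X$, the action extends to a continuous action on the completion $\tilde X$ of $(X,\mathcal U)$, $\tilde X$ is a $G$-Tychonoff space and $X$ is a dense invariant subset of it; such a $\tilde X$ is called a $G$-extension of $X$. A group $G$ is representable in $X$ if it is a subgroup of the homeomorphism group of $X$. The $g$-topology $\tau_g$ on $G$ has as subbase the sets $[K,O]=\{g\in G\mid gK\subset O\}$, $K$ closed in $X$, $O$ open in $X$, with $K$ compact or $X\setminus O$ compact. A topological group $(G,\tau)$ is $\tau_g$-representable in $X$ if $G$ is representable in $X$, $\tau=\tau_g$, and $X$ is a $G$-Tychonoff space under the natural action of $(G,\tau)$. The representation of $G$ in $Y$ is by the extended action. *)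

(* Defs.v *)
From HB Require Import structures.
From mathcomp Require Import all_boot all_order all_algebra.
From mathcomp Require Import all_classical all_reals all_analysis.

Set Implicit Arguments.
Unset Strict Implicit.
Unset Printing Implicit Defensive.

Local Open Scope classical_set_scope.
Local Open Scope group_scope.

HB.mixin Record isTopologicalGroup G & Topological G & Group G := {
  mulg_continuous : continuous (fun p : G * G => p.1 * p.2);
  invg_continuous : continuous (fun g : G => g^-1)
}.

#[short(type="topologicalGroupType")]
HB.structure Definition TopologicalGroup :=
  {G of Topological G & Group G & isTopologicalGroup G}.

Definition tychonoff_space (X : topologicalType) : Prop :=
  hausdorff_space X /\ completely_regular_space X.

Definition homeomorphism (X Y : topologicalType) (f : X -> Y) : Prop :=
  exists f' : Y -> X,
    [/\ cancel f f', cancel f' f, continuous f & continuous f'].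

(* The uniformities inducing the given topology of X: the mixin requires the
   entourages to generate the neighbourhoods of X. *)
Definition uniformity (X : topologicalType) : Type := Nbhs_isUniform_mixin X.

Definition uspace (X : topologicalType) (U : uniformity X) : uniformType :=
  let m : Nbhs_isUniform_mixin X := U in HB.pack_for uniformType X m.

(* The covers refined by {E[x] | x in X} for some entourage E. Together they
   are the description of the uniformity by covers. *)
Definition uniform_cover (X : uniformType) (u : set (set X)) : Prop :=
  exists2 E : set (X * X), entourage E &
    forall x, exists2 W, u W & xsection E x `<=` W.

(* completeType is not used because its carriers are pointed, which would
   exclude the empty space. *)
Definition complete_space (X : uniformType) : Prop :=
  forall F : set_system X, ProperFilter F -> cauchy F -> exists x : X, F --> x.

(* Hausdorff completion, up to isomorphism: i identifies X with a dense
   uniform subspace of Y. *)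
Definition is_completion (X Y : uniformType) (i : X -> Y) : Prop :=
  [/\ hausdorff_space Y,
      complete_space Y,
      injective i,
      (forall E : set (X * X), entourage E <->
         exists2 F : set (Y * Y), entourage F &
           [set p | F (i p.1, i p.2)] `<=` E)
    & dense (range i)].

Definition is_action (G : groupType) (X : Type) (act : G -> X -> X) : Prop :=
  (forall x, act 1 x = x) /\ (forall g h x, act (g * h) x = act g (act h x)).

Definition effective (G : groupType) (X : Type) (act : G -> X -> X) : Prop :=
  forall g, (forall x, act g x = x) -> g = 1.

Definition is_Gspace (G : topologicalGroupType) (X : topologicalType)
    (act : G -> X -> X) : Prop :=
  [/\ tychonoff_space X, is_action act, effective act
    & continuous (fun p : G * X => act p.1 p.2)].

Definition equiuniformity (G : topologicalGroupType) (X : topologicalType)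
    (act : G -> X -> X) (U : uniformity X) : Prop :=
  (forall g, unif_continuous (act g : uspace U -> uspace U)) /\
  (forall u : set (set X), uniform_cover (u : set (set (uspace U))) ->
     exists (O : set G) (v : set (set X)),
       [/\ nbhs 1 O, uniform_cover (v : set (set (uspace U)))
         & forall V, v V -> exists2 W, u W &
             [set act g x | g in O & x in V] `<=` W]).

Definition G_Tychonoff (G : topologicalGroupType) (X : topologicalType)
    (act : G -> X -> X) : Prop :=
  is_Gspace act /\ exists U : uniformity X, equiuniformity act U.

(* The action on the completion is the extended one: actY g is the (unique)
   continuous map extending actX g. *)
Definition G_extension (G : topologicalGroupType) (X Y : topologicalType)
    (actX : G -> X -> X) (i : X -> Y) (actY : G -> Y -> Y) : Prop :=
  exists (U : uniformity X) (V : uniformity Y),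
    [/\ equiuniformity actX U,
        is_completion (i : uspace U -> uspace V),
        (forall g, continuous (actY g))
      & (forall g x, actY g (i x) = i (actX g x))].

(* g |-> act g embeds G as a subgroup of the homeomorphism group of X. *)
Definition representable (G : groupType) (X : topologicalType)
    (act : G -> X -> X) : Prop :=
  [/\ is_action act, effective act & forall g, homeomorphism (act g)].

Definition g_subbase (G : Type) (X : topologicalType) (act : G -> X -> X) :
    set (set G) :=
  [set W | exists K O : set X,
     [/\ closed K, open O, compact K \/ compact (~` O)
       & W = [set g | act g @` K `<=` O]]].

(* Open sets of the g-topology: unions of finite intersections of members of
   the subbase. *)
Definition g_topology (G : Type) (X : topologicalType) (act : G -> X -> X) :
    set (set G) :=
  [set \bigcup_(W in D) W | D in subset^~ (finI_from (g_subbase act) id)].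

Definition tau_g_representable (G : topologicalGroupType) (X : topologicalType)
    (act : G -> X -> X) : Prop :=
  [/\ representable act, @open G = g_topology act & G_Tychonoff act].

(* Main.v *)
Require Import Defs.
From mathcomp Require Import all_boot all_order all_algebra.
From mathcomp Require Import all_classical all_reals all_analysis.

(* An equiuniformity, its entourages and the group action all extend from the
   dense subspace X to Y, so Y is a G-Tychonoff space. Joint continuity makes
   every [K, O] in Y open in G, since one of K and ~` O is compact. Conversely
   every [K, O] in X is of the same form in Y: if K is compact then i @` K is
   still compact and O is the trace of an open set; if ~` O is compact then
   [K, O] = [closure (i @` K), ~` (i @` ~` O)], because the closure of i @` K
   adds no point of the invariant set range i. *)

Set Implicit Arguments.
Unset Strict Implicit.
Unset Printing Implicit Defensive.

Local Open Scope classical_set_scope.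
Local Open Scope group_scope.

(** * Density arguments and separation in uniform spaces *)

Lemma dense_nbhs (T : topologicalType) (S : set T) (x : T) (A : set T) :
  dense S -> nbhs x A -> exists2 y, S y & A y.
Proof.
move=> dS nA; have [|y [Ay Sy]] := dS A° _ (@open_interior _ _).
  by exists x.
by exists y => //; apply: interior_subset.
Qed.

Lemma dense_continuous_eq (T Z : topologicalType) (S : set T) (f g : T -> Z) :
  hausdorff_space Z -> dense S -> continuous f -> continuous g ->
  (forall x, S x -> f x = g x) -> f =1 g.
Proof.
move=> hZ dS cf cg fg x; apply: hZ => A B nA nB.
have nAf : nbhs x (f @^-1` A) := cf x _ nA.
have nBg : nbhs x (g @^-1` B) := cg x _ nB.
have [y Sy [Ay By]] := dense_nbhs dS (filterI nAf nBg).
by exists (f y); split; rewrite ?fg // -fg.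
Qed.

Lemma uniform_space_completely_regular (T : uniformType) :
  completely_regular_space T.
Proof.
move=> x B cB Bx; apply: uniform_separatorW.
have : nbhs x (~` B) by apply: open_nbhs_nbhs; split => //; exact: closed_openC.
rewrite nbhsP => -[E entE EB]; exists E => //.
rewrite -subset0 => -[a b] [/= [-> Bb] Eab].
by apply: (EB b) => //; exact/xsectionP.
Qed.

(** Approximate [y] and [y'] by points [i x] and [i x']. The resulting chains in [Y] and in [Z] have
    three links each, hence the double [split_ent] on both sides. Two maps [f] and [h] are allowed
    so that the actions of two different group elements can be compared. *)
Lemma dense_entourage (X : Type) (Y Z : uniformType) (i : X -> Y)
    (E : set (Z * Z)) (F : set (Y * Y)) (f h : Y -> Z) :
  dense (range i) -> entourage E -> entourage F ->
  continuous f -> continuous h ->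
  (forall x x', F (i x, i x') ->
     split_ent (split_ent E) (f (i x), h (i x'))) ->
  forall y y', split_ent (split_ent F) (y, y') -> E (f y, h y').
Proof.
move=> di eE eF cf ch FE y y' Fyy'.
pose E1 := split_ent (split_ent E); pose F1 := split_ent (split_ent F).
have eE1 : entourage E1 by apply: entourage_split_ent.
have eF1 : entourage F1 by apply: entourage_split_ent.
have n1 : \forall z \near y, E1 (f y, f z) /\ F1 (z, y).
  apply: filterI; first exact: (cvg_entourage (cf y)).
  exact: (cvg_entourage (@cvg_id _ (nbhs y)) (entourage_inv eF1)).
have n2 : \forall z \near y', E1 (h z, h y') /\ F1 (y', z).
  apply: filterI; last exact: (cvg_entourage (@cvg_id _ (nbhs y')) eF1).
  exact: (cvg_entourage (ch y') (entourage_inv eE1)).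
have [_ [x _ <-] [Efx Fx]] := dense_nbhs di n1.
have [_ [x' _ <-] [Ehx' Fx']] := dense_nbhs di n2.
apply: (entourage_split (f (i x))) => //; first exact: split_ent_subset.
apply: (entourage_split (h (i x'))) => //.
apply: FE; apply: (entourage_split y) => //; first exact: split_ent_subset.
exact: (entourage_split y').
Qed.

(** * Uniform embeddings are topological embeddings *)

Section uniform_embedding.
Context (X Y : uniformType) (i : X -> Y).
Hypothesis ientourage : forall E : set (X * X), entourage E <->
  exists2 F : set (Y * Y), entourage F & [set p | F (i p.1, i p.2)] `<=` E.

Lemma entourage_embedding_continuous : continuous i.
Proof.
move=> x; apply/cvg_app_entourageP => F eF.
have eE : entourage [set p | F (i p.1, i p.2)] by apply/ientourage; exists F.
by apply: filterS (nbhs_entourage x eE) => z /xsectionP.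
Qed.

(** A neighbourhood of [x] missing [K] contains the trace of some [F]-ball around [i x], and that
    ball then misses the image of [K]. *)
Lemma entourage_embedding_closure (K : set X) (x : X) :
  closed K -> closure (i @` K) (i x) -> K x.
Proof.
move=> cK clx; apply: contrapT => nKx.
have : nbhs x (~` K) by apply: open_nbhs_nbhs; split => //; exact: closed_openC.
rewrite nbhsP => -[E /ientourage[F eF FE] EK].
have [_ [[k Kk <-] /xsectionP Fk]] := clx _ (nbhs_entourage (i x) eF).
by apply: (EK k) => //; apply/xsectionP; exact: FE.
Qed.

End uniform_embedding.

(** * Equiuniformities in terms of entourages *)

Section equiuniform_entourage.
Context (G : topologicalGroupType) (X : topologicalType) (act : G -> X -> X).
Context (U : uniformity X).

(** Entourage form of the cover condition, better suited to passing to limits. The elements [g] and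
    [h] are independent, so one of them may be taken to be [1]. *)
Definition equiuniform_entourage : Prop :=
  forall E : set (uspace U * uspace U), entourage E ->
  exists (N : set G) (F : set (uspace U * uspace U)),
    [/\ nbhs 1 N, entourage F & forall g h x y, N g -> N h -> F (x, y) ->
      E (act g x, act h y)].

(** For the cover by [E1]-balls, [act g x] and [act h y] fall into a common ball and are linked
    through its centre [z]. Symmetrizing [E1] allows the first link to be reversed. *)
Lemma equiuniformity_entourage :
  equiuniformity act U -> equiuniform_entourage.
Proof.
move=> [_ eqU] E eE; pose E1 := split_ent E `&` ((split_ent E)^-1)%relation.
have eE1 : entourage E1 by apply: entourage_invI; exact: entourage_split_ent.
have [/=|N [v [nN [F eF Fv] vu]]] :=
    eqU [set W | exists x, W = xsection (E1 : set (uspace U * uspace U)) x].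
  by exists E1 => // x; exists (xsection E1 x) => //; exists x.
exists N, F; split=> // g h x y Ng Nh Fxy.
have [V vV FV] := Fv x; have [_ [z ->] sub] := vu V vV.
have /xsectionP[_ ?] : xsection E1 z (act g x).
  apply: sub; exists g => //; exists x => //.
  by apply/FV/xsectionP; exact: entourage_refl.
have /xsectionP[? _] : xsection E1 z (act h y).
  by apply: sub; exists h => //; exists y => //; apply/FV/xsectionP.
exact: (entourage_split z).
Qed.

Lemma entourage_equiuniformity : is_action act ->
  (forall g, unif_continuous (act g : uspace U -> uspace U)) ->
  equiuniform_entourage -> equiuniformity act U.
Proof.
move=> [act1 _] ucact eqU; split=> // u [E eE Eu].
have [N [F [nN eF NFE]]] := eqU E eE.
exists N, [set V | exists x, V = xsection F x]; split=> //.
  by exists F => // x; exists (xsection F x) => //; exists x.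
move=> _ [x ->]; have [W uW EW] := Eu x; exists W => //.
move=> _ [g Ng [y /xsectionP Fxy <-]]; apply/EW/xsectionP.
(* With [1] as the first group element, the [N]-translates of the [F]-ball at [x] stay in the
   [E]-ball at [x]. *)
by rewrite -[x]act1; apply: NFE => //; exact: nbhs_singleton.
Qed.

Lemma equiuniform_continuous : is_action act ->
  (forall g, continuous (act g)) -> equiuniform_entourage ->
  continuous (fun p : G * X => act p.1 p.2).
Proof.
move=> [act1 actM] cact eqU [g y] /=.
(* Factoring out the homeomorphism [act g] moves the question from [g] to the identity, where the
   neighbourhood [N] is available. *)
have actE : act g \o (fun p : G * X => act (g^-1 * p.1) p.2) =
    (fun p : G * X => act p.1 p.2).
  by apply/funext => p /=; rewrite -actM mulVKg.
suff cy : (fun p : G * X => act (g^-1 * p.1) p.2) @ (g, y) --> y.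
  by have := cvg_comp _ _ cy (cact g y); rewrite actE.
apply/(@cvg_app_entourageP (uspace U)).
move=> E /eqU[N [F [nN eF NFE]]].
have nN' : \forall h \near g, N (g^-1 * h).
  have cm : (fun h : G => g^-1 * h) @ g --> g^-1 * g.
    apply: (@continuous2_cvg _ _ _ _ _ _ (fun=> g^-1) id
      (fun a b : G => a * b)).
    - exact: (mulg_continuous (g^-1, g)).
    - exact: cvg_cst.
    - exact: cvg_id.
  by apply: cm; rewrite mulVg.
exists ([set h | N (g^-1 * h)], xsection F y).
  by split => /=; [|exact: (@nbhs_entourage (uspace U))].
move=> [h z] /= [Nh /xsectionP Fyz]; rewrite -{1}(act1 y).
by apply: NFE => //; exact: nbhs_singleton.
Qed.

End equiuniform_entourage.

(** * Comparison of g-topologies with the topology of the group *)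

Section g_topology_lemmas.
Context (G : topologicalGroupType).

(** Tube argument: joint continuity gives a neighbourhood of [g] for each point of [K], and
    compactness makes it uniform over [K]. *)
Lemma compact_open_open (X : topologicalType) (act : G -> X -> X)
    (K O : set X) :
  continuous (fun p : G * X => act p.1 p.2) -> compact K -> open O ->
  open [set g | act g @` K `<=` O].
Proof.
move=> cact /compact_near_coveringP cK oO; rewrite openE => g /= gKO.
have := cK G (nbhs g) (fun h x => O (act h x)) _.
have H x : K x -> \forall x' \near x & h \near g, O (act h x').
  move=> Kx; have nO : nbhs (act g x) O.
    by apply: open_nbhs_nbhs; split => //; apply: gKO; exists x.
  have [[A B] /= [nA nB] AB] := cact (g, x) _ nO.
  by exists (B, A) => // -[x' h] /= [Bx' Ah]; exact: (AB (h, x')).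
move=> /(_ _ H); apply: filterS => h hKO _ [x Kx <-]; exact: hKO.
Qed.

Lemma g_subbase_open (X : topologicalType) (act : G -> X -> X) :
  is_action act -> continuous (fun p : G * X => act p.1 p.2) ->
  g_subbase act `<=` open.
Proof.
move=> [act1 actM] cact _ [K [ O [cK oO [kK|kO] ->]]].
  exact: compact_open_open.
(* Passing to complements and inverses exchanges the two kinds of subbasic sets, which reduces this
   case to the compact one. *)
have -> : [set g | act g @` K `<=` O] =
    (fun g : G => g^-1) @^-1` [set g | act g @` (~` O) `<=` ~` K].
  apply/seteqP; split => g /= gKO.
    move=> _ [x nOx <-] Kx; apply: nOx; apply: gKO.
    by exists (act g^-1 x) => //; rewrite -actM mulgV.
  move=> _ [x Kx <-]; apply: contrapT => nO.
  by apply: gKO Kx; exists (act g x) => //; rewrite -actM mulVg.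
apply: open_comp; first by move=> g _; exact: invg_continuous.
by apply: compact_open_open => //; exact: closed_openC.
Qed.

Lemma g_topology_open (X : topologicalType) (act : G -> X -> X) :
  is_action act -> continuous (fun p : G * X => act p.1 p.2) ->
  g_topology act `<=` open.
Proof.
move=> aact cact _ [D sD <-]; apply: bigcup_open => _ /sD [D' sD' <-].
rewrite openE => g gD'; apply: filter_bigI => W WD'.
apply: open_nbhs_nbhs; split; last exact: gD'.
by apply: (g_subbase_open aact cact); exact/set_mem/sD'.
Qed.

Lemma g_topology_subset (X Y : topologicalType) (actX : G -> X -> X)
    (actY : G -> Y -> Y) :
  g_subbase actX `<=` g_subbase actY -> g_topology actX `<=` g_topology actY.
Proof.
move=> sXY _ [D sD <-]; exists D => // W /sD [D' sD' <-]; exists D' => //.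
by move=> V /sD'; rewrite !inE; exact: sXY.
Qed.

Lemma g_subbase_extension (X Y : topologicalType) (actX : G -> X -> X)
    (i : X -> Y) (actY : G -> Y -> Y) :
  hausdorff_space Y -> continuous i ->
  (forall K x, closed K -> closure (i @` K) (i x) -> K x) ->
  is_action actX -> is_action actY ->
  (forall g x, actY g (i x) = i (actX g x)) ->
  g_subbase actX `<=` g_subbase actY.
Proof.
move=> hY ci icl [actX1 actXM] [actY1 actYM] iact.
move=> _ [K [ O [cK oO [kK|kO] ->]]].
- have kiK : compact (i @` K).
    by apply: continuous_compact => //; exact: continuous_subspaceT.
  (* The largest open set of [Y] whose trace on [X] is [O]. *)
  exists (i @` K), (~` closure (i @` (~` O))); split => //.
  + exact: compact_closed.
  + exact/closed_openC/closed_closure.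
  + by left.
  + apply/seteqP; split => g /= gKO.
      move=> _ [_ [x Kx <-] <-]; rewrite iact => /(icl _ _ (open_closedC oO)).
      by apply; apply: gKO; exists x.
    move=> _ [x Kx <-]; apply: contrapT => nO.
    have /gKO : (actY g @` (i @` K)) (actY g (i x)).
      by exists (i x) => //; exists x.
    by apply; apply: subset_closure; rewrite iact; exists (actX g x).
- have kiO : compact (i @` (~` O)).
    by apply: continuous_compact => //; exact: continuous_subspaceT.
  exists (closure (i @` K)), (~` (i @` (~` O))); split.
  + exact: closed_closure.
  + by apply: closed_openC; exact: compact_closed.
  + by right; rewrite setCK.
  + apply/seteqP; split => g /= gKO.
      move=> _ [y cly <-] [x nOx ix]; apply: nOx; apply: gKO.
      (* If [actY g y] is [i x], then [y] is the image of [actX g^-1 x]; so only points of [range i]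
         matter in the closure, and those come from [K]. *)
      exists (actX g^-1 x); last by rewrite -actXM mulgV.
      by apply: icl => //; rewrite -iact ix -actYM mulVg actY1.
    move=> _ [x Kx <-]; apply: contrapT => nO.
    have /gKO : (actY g @` closure (i @` K)) (actY g (i x)).
      by exists (i x) => //; apply: subset_closure; exists x.
    by apply; rewrite iact; exists (actX g x).
Qed.

End g_topology_lemmas.

(** * Extending the action and its equiuniformity to the completion *)

Section extension.
Context (G : topologicalGroupType) (X Y : topologicalType).
Context (actX : G -> X -> X) (i : X -> Y) (actY : G -> Y -> Y).
Context (U : uniformity X) (V : uniformity Y).
Hypothesis di : dense (range i).
Hypothesis ientourage : forall E : set (uspace U * uspace U), entourage E <->
  exists2 F : set (uspace V * uspace V), entourage F &
    [set p | F (i p.1, i p.2)] `<=` E.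
Hypothesis cactY : forall g, continuous (actY g).
Hypothesis iact : forall g x, actY g (i x) = i (actX g x).

Lemma action_extension :
  hausdorff_space Y -> is_action actX -> is_action actY.
Proof.
move=> hY [act1 actM]; split=> [|g h].
  apply: (dense_continuous_eq hY di) => //; first by move=> x; exact: cvg_id.
  by move=> _ [x _ <-]; rewrite iact act1.
apply: (dense_continuous_eq hY di) => //.
  by move=> x; apply: continuous_comp; exact: cactY.
by move=> _ [x _ <-]; rewrite !iact actM.
Qed.

Lemma unif_continuous_extension g :
  unif_continuous (actX g : uspace U -> uspace U) ->
  unif_continuous (actY g : uspace V -> uspace V).
Proof.
move=> ucg E eE.
have /ucg/ientourage[F eF FE] : entourage
    [set p : uspace U * uspace U | split_ent (split_ent E) (i p.1, i p.2)].
  apply/ientourage; exists (split_ent (split_ent E)); last by move=> p.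
  exact: entourage_split_ent.
have eF2 : entourage (split_ent (split_ent F)) by [].
apply: filterS eF2 => -[y y'] /=.
apply: (@dense_entourage _ (uspace V) (uspace V) i E F (actY g) (actY g)) => //;
  try exact: cactY.
by move=> x x' /(FE (x, x')); rewrite !iact.
Qed.

(** The neighbourhood [N] found for the trace of [E] on [X] also serves on [Y], since the estimate
    passes to limits for each fixed pair of group elements. *)
Lemma equiuniform_entourage_extension :
  equiuniform_entourage actX U -> equiuniform_entourage actY V.
Proof.
move=> eqU E eE.
have /eqU[N [F [nN /ientourage[F' eF' FF'] NF]]] : entourage
    [set p : uspace U * uspace U | split_ent (split_ent E) (i p.1, i p.2)].
  apply/ientourage; exists (split_ent (split_ent E)); last by move=> p.
  exact: entourage_split_ent.
exists N, (split_ent (split_ent F')); split => //.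
move=> g h y y' Ng Nh.
apply: (@dense_entourage _ (uspace V) (uspace V) i E F' (actY g) (actY h))
  => //; try exact: cactY.
by move=> x x' /(FF' (x, x')) Fxx'; rewrite !iact; exact: (NF g h x x').
Qed.

End extension.

Theorem lemma2p11 (G : topologicalGroupType) (X Y : topologicalType)
    (actX : G -> X -> X) (i : X -> Y) (actY : G -> Y -> Y)
    (hG : tychonoff_space G)
    (hX : tau_g_representable actX)
    (hY : G_extension actX i actY) :
  tau_g_representable actY.
Proof.
have [[aX effX _] oG _] := hX.
have [U [V [eqU [hausY _ inji ient di] cactY iact]]] := hY.
have aY : is_action actY := action_extension di cactY iact hausY aX.
have effY : effective actY.
  by move=> g g1; apply: effX => x; apply: inji; rewrite -iact.
have ucY g : unif_continuous (actY g : uspace V -> uspace V).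
  exact: (unif_continuous_extension di ient cactY iact (eqU.1 g)).
have eqV : equiuniform_entourage actY V.
  apply: (equiuniform_entourage_extension di ient cactY iact).
  exact: equiuniformity_entourage.
have jcY := equiuniform_continuous aY cactY eqV.
split.
- split=> // g; exists (actY g^-1); have [act1 actM] := aY.
  by split=> // y; rewrite -actM ?mulVg ?mulgV.
- apply/seteqP; split; last exact: g_topology_open.
  (* The open sets of [G] are already generated by the subbase coming from [X], so it suffices to
     compare subbases. *)
  rewrite oG; apply: g_topology_subset.
  apply: (@g_subbase_extension _ _ _ _ i) => //.
    exact: (@entourage_embedding_continuous (uspace U) (uspace V)).
  exact: (@entourage_embedding_closure (uspace U) (uspace V)).
- split; last by exists V; exact: entourage_equiuniformity.
  split=> //; split=> //.
  exact: (@uniform_space_completely_regular (uspace V)).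
Qed.
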